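(* Let $L$ be a non-negative integer, $f$ a positive integer, and for non-negative integers $n_1,\dots,n_f$ put $N_i:=n_i+n_{i+1}+\dots+n_f$ for $i=1,\dots,f$. Then \[ \sum_{m,n,n_1,\dots,n_f\geq 0}\frac{q^{2m^2+6mn+6n^2+m+3n+3(N_1^2+\dots+N_f^2+N_1+\dots+N_f)}(1+q^{1+2m+3n})(q^3;q^3)_{2L+1}(q^3;q^3)_{n_f}}{(q;q)_m(q^3;q^3)_n(q^3;q^3)_{L-N_1}(q^3;q^3)_{n_f-2n-m}(q^3;q^3)_{n_1}\cdots(q^3;q^3)_{n_{f-1}}(q^3;q^3)_{2n_f+1}}=\sum_{j=-L-1}^{L+1}q^{3(f+1)j^2+(3f+2)j}{2L+1\brack L-j}_{q^3}. \]
   Context: $(a;p)_n=\prod_{k=0}^{n-1}(1-ap^k)$ for a base $p$ (here $p=q$ or $p=q^3$). By convention $1/(q;q)_n=0$ and $1/(q^3;q^3)_n=0$ for negative integers $n$, so summands with a negative index in a denominator vanish. The $q$-binomial coefficient is ${m+n\brack m}_p=\frac{(p;p)_{m+n}}{(p;p)_m(p;p)_n}$ for $m,n\ge0$ and $0$ otherwise. *)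

(* Defs.v *)
From mathcomp Require Import all_boot all_order all_algebra.
From mathcomp Require Import boolp classical_sets cardinality fsbigop.

Set Implicit Arguments.
Unset Strict Implicit.
Unset Printing Implicit Defensive.

Import Order.TTheory GRing.Theory Num.Theory.
Local Open Scope classical_set_scope.
Local Open Scope ring_scope.

Definition qpoch (F : fieldType) (a p : F) (n : nat) : F :=
  \prod_(0 <= k < n) (1 - a * p ^+ k).

(* 1 / (p;p)_n, equal to 0 for negative n. *)
Definition inv_qpoch (F : fieldType) (p : F) (n : int) : F :=
  match n with
  | Posz k => (qpoch p p k)^-1
  | Negz _ => 0
  end.

(* The coefficient [a, k]_p, i.e. [m + n, m]_p with m = k and n = a - k. *)
Definition qbinom (F : fieldType) (p : F) (a k : int) : F :=
  match k, a - k with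
  | Posz m, Posz n => qpoch p p (m + n) / (qpoch p p m * qpoch p p n)
  | _, _ => 0
  end.

(* A tuple ns lists n_1, ..., n_f, so the 1-based n_i sits at position i - 1. *)
Definition part (f : nat) (ns : f.-tuple nat) (i : nat) : nat := nth 0%N ns i.-1.

Definition tail_sum (f : nat) (ns : f.-tuple nat) (i : nat) : nat :=
  (\sum_(i <= k < f.+1) part ns k)%N.

Definition summand (F : fieldType) (q : F) (L f m n : nat) (ns : f.-tuple nat)
    : F :=
  let n_ := part ns in
  let N_ := tail_sum ns in
  q ^+ (2 * m ^ 2 + 6 * m * n + 6 * n ^ 2 + m + 3 * n
        + 3 * \sum_(1 <= i < f.+1) (N_ i ^ 2 + N_ i))%N
  * (1 + q ^+ (1 + 2 * m + 3 * n)%N)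
  * qpoch (q ^+ 3) (q ^+ 3) (2 * L + 1)%N
  * qpoch (q ^+ 3) (q ^+ 3) (n_ f)
  * inv_qpoch q m%:Z
  * inv_qpoch (q ^+ 3) n%:Z
  * inv_qpoch (q ^+ 3) (L%:Z - (N_ 1%N)%:Z)
  * inv_qpoch (q ^+ 3) ((n_ f)%:Z - 2 * n%:Z - m%:Z)
  * (\prod_(1 <= i < f) inv_qpoch (q ^+ 3) (n_ i)%:Z)
  * inv_qpoch (q ^+ 3) (2 * (n_ f)%:Z + 1).

Lemma part_le_tail_sum (f : nat) (ns : f.-tuple nat) (i : nat) :
  (0 < i <= f)%N -> (part ns i <= tail_sum ns 1)%N.
Proof.
move=> /andP[i_gt0 i_le]; rewrite /tail_sum (bigD1_seq i) ?iota_uniq //=.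
  exact: leq_addr.
by rewrite mem_index_iota i_gt0 ltnS.
Qed.

Lemma inv_qpoch_neq0 (F : fieldType) (p : F) (n : int) :
  inv_qpoch p n != 0 -> 0 <= n.
Proof. by case: n => [k|k] //=; rewrite eqxx. Qed.

(* The finitely supported sum \sum_(x \in A) is 0 by convention on an infinite
   support; this shows that the convention is never used for [summand]. *)
Lemma finite_summand (F : fieldType) (q : F) (L f : nat) : (0 < f)%N ->
  finite_set [set x : nat * nat * f.-tuple nat |
              summand q L x.1.1 x.1.2 x.2 != 0].
Proof.
move=> f_gt0.
pose g (y : 'I_L.+1 * 'I_L.+1 * f.-tuple 'I_L.+1) : nat * nat * f.-tuple nat :=
  (y.1.1 : nat, y.1.2 : nat, map_tuple (@nat_of_ord L.+1) y.2).
apply: (@sub_finite_set _ _ (g @` setT)); last first.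
  exact: finite_image (@finite_finset _ setT).
move=> [[m n] ns] /=; rewrite /summand !mulf_eq0 !negb_or.
move=> /andP[/andP[/andP[/andP[_ hN] hm] _] _].
move/inv_qpoch_neq0: hN; rewrite subr_ge0 lez_nat => hN.
move/inv_qpoch_neq0: hm; rewrite -addrA -opprD subr_ge0 -PoszM -PoszD lez_nat.
have hp i : (0 < i <= f)%N -> (part ns i <= L)%N.
  by move=> hi; apply: leq_trans hN; apply: part_le_tail_sum.
move=> /leq_trans/(_ (hp f _)); rewrite f_gt0 leqnn => /(_ isT) hmn.
have m_le : (m < L.+1)%N by rewrite ltnS (leq_trans _ hmn) ?leq_addl.
have n_le : (n < L.+1)%N.
  rewrite ltnS (leq_trans _ hmn) // (leq_trans _ (leq_addr _ _)) //.
  by rewrite leq_pmull.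
exists (Ordinal m_le, Ordinal n_le, map_tuple (@inord L) ns) => //.
rewrite /g /=; congr (_, _, _); apply/val_inj => /=; rewrite -map_comp.
apply/map_id_in => x /(nthP 0%N)[i]; rewrite size_tuple => i_lt <- /=.
by rewrite inordK // ltnS; apply: (hp i.+1).
Qed.

(* Main.v *)
Require Import Defs.
From mathcomp Require Import all_boot all_order all_algebra.
From mathcomp Require Import boolp classical_sets cardinality fsbigop.
From mathcomp Require Import ring zify.

(* Write p = q^3. By the finite Bailey lemma (q-Vandermonde, [bailey_step]) the
   sum over n_1, ..., n_f multiplies the coefficient of [2M+1, M-j]_p by
   p^(f(j^2+j)), which reduces the theorem to the case "f = 0",

     sum_(m,n) q^(2m^2+6mn+6n^2+m+3n) (1+q^(1+2m+3n)) (p;p)_M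
               / ((q;q)_m (p;p)_n (p;p)_(M-2n-m))
     = sum_j q^(3j^2+2j) [2M+1, M-j]_p.

   Both sides agree at M = 0 and satisfy, with w = q + 1/q,

     X_(M+1) = (1 + p + p^(2M+2) w) X_M - p (1-p^(2M)) (1-p^(2M+1)) X_(M-1).

   On the right, q^(-j) + q^(j+1) is multiplied by w through a shift of j, and
   the recurrence holds coefficientwise. On the left, put s = m + 2n: the
   exponent is 3 binom(s+1, 2) + binom(m, 2), so X_M is the pairing of
   p^binom(s+1, 2) (p;p)_M / (p;p)_(M-s) with the coefficients of
   (1+q) (1+x) (-q^2 x; q)_oo / (x^2; p)_oo, and the recurrence is a multiple
   of the p-difference equation of that product. *)

Set Implicit Arguments.
Unset Strict Implicit.

Import Order.TTheory GRing.Theory Num.Theory.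
Local Open Scope classical_set_scope.
Local Open Scope ring_scope.

(** * Truncated sums over the natural numbers *)

Section NatSums.
Variable F : fieldType.
Implicit Type G : nat -> F.

Lemma sum_nat_widen G n B : (n <= B)%N -> (forall k, (n <= k)%N -> G k = 0) ->
  \sum_(0 <= k < B) G k = \sum_(0 <= k < n) G k.
Proof.
move=> nB G0; rewrite (big_cat_nat (leq0n n) nB) //= [X in _ + X]big_nat_cond.
by rewrite [X in _ + X]big1 ?addr0 // => k /andP[/andP[/G0]].
Qed.

(** Sums are cut at a common bound [B] beyond their support, so reindexing by [a] leaves the range
    unchanged. *)
Lemma sum_nat_shift G a B :
  (forall k, (k < a)%N -> G k = 0) -> (forall k, (B <= k)%N -> G k = 0) ->
  \sum_(0 <= k < B) G (k + a)%N = \sum_(0 <= k < B) G k.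
Proof.
move=> Ga GB; rewrite -(sum_nat_widen (leq_addr a B) GB).
rewrite (@big_cat_nat _ _ _ a _ (B + a)%N) ?leq_addl //=.
rewrite [X in _ = X + _]big_nat_cond [X in _ = X + _]big1 ?add0r; last first.
  by move=> k /andP[/andP[_ /Ga]].
by rewrite -{2}[a]add0n big_addn addnK.
Qed.
End NatSums.

Local Arguments inv_qpoch : simpl never.

(** * Reciprocal q-factorials and the finite Bailey lemma *)

Section InvQpoch.
Variables (F : fieldType) (p : F).
Hypothesis hp : forall k : nat, (0 < k)%N -> p ^+ k != 1.

Lemma qpochS n : qpoch p p n.+1 = (1 - p ^+ n.+1) * qpoch p p n.
Proof. by rewrite /qpoch big_nat_recr //= -exprS mulrC. Qed.

Lemma qpoch_neq0 n : qpoch p p n != 0.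
Proof.
elim: n => [|n IH]; first by rewrite /qpoch big_nil oner_neq0.
by rewrite qpochS mulf_neq0 // subr_eq0 eq_sym hp.
Qed.

Lemma inv_qpoch_pred (n : nat) :
  inv_qpoch p n%:Z = (1 - p ^+ n.+1) * inv_qpoch p n.+1%:Z.
Proof.
rewrite /inv_qpoch qpochS invfM mulrA divff ?mul1r //.
by rewrite subr_eq0 eq_sym hp.
Qed.

Lemma inv_qpoch_lt (n k : nat) : (n < k)%N -> inv_qpoch p (n%:Z - k%:Z) = 0.
Proof.
move=> nk; have -> : n%:Z - k%:Z = Negz (k - n).-1 by lia.
by [].
Qed.

(* Both sides vanish for [n < k], so this identity needs no side condition. *)
Lemma inv_qpochB (n k : nat) :
  p ^+ k * inv_qpoch p (n%:Z - k%:Z)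
  = (p ^+ k - p ^+ n.+1) * inv_qpoch p (n.+1%:Z - k%:Z).
Proof.
case: (leqP k n) => [kn|nk].
  have -> : n%:Z - k%:Z = (n - k)%N%:Z by lia.
  have -> : n.+1%:Z - k%:Z = (n - k).+1%:Z by lia.
  rewrite inv_qpoch_pred -[in p ^+ n.+1](subnKC kn) -addnS exprD; ring.
rewrite inv_qpoch_lt // mulr0; case: (eqVneq k n.+1) => [->|ne].
  by rewrite subrr mul0r.
by rewrite inv_qpoch_lt ?mulr0 //; lia.
Qed.

(** The q-Pascal rule, from 1 - p^(n+1) = (p^k - p^(n+1)) + (1 - p^k). The factor 1 - p^k is left
    uncancelled so that the second term visibly vanishes at [k = 0]. *)
Lemma q_pascal (n k : nat) :
  (1 - p ^+ n.+1) * (inv_qpoch p (n.+1%:Z - k%:Z) * inv_qpoch p k%:Z)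
  = p ^+ k * inv_qpoch p (n%:Z - k%:Z) * inv_qpoch p k%:Z
    + inv_qpoch p (n.+1%:Z - k%:Z) * ((1 - p ^+ k) * inv_qpoch p k%:Z).
Proof. rewrite inv_qpochB; ring. Qed.

(** The case of q-Vandermonde that counts partitions by Durfee rectangles. Induction on [n] for all
    [a]: after [q_pascal], shifting [k] in the second half lets the two halves combine into the sum
    for [n] and [a.+1]. *)
Lemma durfee_sum (n a B : nat) : (n < B)%N ->
  \sum_(0 <= k < B) p ^+ (k * (k + a)) * inv_qpoch p (n%:Z - k%:Z)
     * inv_qpoch p k%:Z * inv_qpoch p (k + a)%N%:Z
  = inv_qpoch p n%:Z * inv_qpoch p (n + a)%N%:Z.
Proof.
elim: n a => [|n IH] a nB.
  rewrite (@sum_nat_widen _ _ 1) ?big_nat1 //=; last first.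
    by move=> k k0; rewrite sub0r (_ : - k%:Z = 0%N%:Z - k%:Z) ?inv_qpoch_lt
      ?mulr0 ?mul0r //; lia.
  by rewrite mul0n !add0n expr0 mul1r subr0 /inv_qpoch /qpoch big_nil invr1 !mul1r.
have nz : 1 - p ^+ n.+1 != 0 by rewrite subr_eq0 eq_sym hp.
apply: (mulfI nz); rewrite mulrA -inv_qpoch_pred addSnnS -IH; last exact: ltnW.
rewrite big_distrr /=.
pose G k := p ^+ (k * (k + a)) * inv_qpoch p (n.+1%:Z - k%:Z) *
  ((1 - p ^+ k) * inv_qpoch p k%:Z) * inv_qpoch p (k + a)%N%:Z.
rewrite (eq_bigr (fun k => p ^+ (k * (k + a)) * (p ^+ k * inv_qpoch p (n%:Z - k%:Z)
  * inv_qpoch p k%:Z) * inv_qpoch p (k + a)%N%:Z + G k)); last first.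
  move=> k _; rewrite /G; move: (q_pascal n k); set x := inv_qpoch p (n.+1%:Z - _).
  set y := inv_qpoch p k%:Z; set z := inv_qpoch p (n%:Z - _).
  set t := inv_qpoch p (k + a)%N%:Z => e.
  transitivity (p ^+ (k * (k + a)) * t * ((1 - p ^+ n.+1) * (x * y))); first ring.
  rewrite e; ring.
rewrite big_split /= -(@sum_nat_shift _ G 1); first last.
- by move=> k Bk; rewrite /G inv_qpoch_lt ?mulr0 ?mul0r //; lia.
- by case=> // _; rewrite /G expr0 subrr mul0r mulr0 mul0r.
rewrite -big_split /=; apply: eq_bigr => k _; rewrite /G addn1 -inv_qpoch_pred.
have -> : n.+1%:Z - k.+1%:Z = n%:Z - k%:Z by lia.
rewrite addSn -addnS (inv_qpoch_pred (k + a)) -addnS.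
have -> : (k.+1 * (k + a.+1) = k * (k + a.+1) + (k + a.+1))%N by lia.
have -> : (k * (k + a.+1) = k * (k + a) + k)%N by lia.
rewrite !exprD; ring.
Qed.

(** With k replaced by k + j this is [durfee_sum] for n = L - j and a = 2j + 1, because (k+j)^2 +
    (k+j) = (j^2+j) + k(k+2j+1). *)
Lemma bailey_step (L j B : nat) : (L < B)%N ->
  \sum_(0 <= k < B) p ^+ (k ^ 2 + k) * inv_qpoch p (L%:Z - k%:Z)
     * (inv_qpoch p (k%:Z - j%:Z) * inv_qpoch p (k + j).+1%:Z)
  = p ^+ (j ^ 2 + j) * (inv_qpoch p (L%:Z - j%:Z) * inv_qpoch p (L + j).+1%:Z).
Proof.
move=> LB; case: (leqP j L) => [jL|Lj]; last first.
  rewrite [in RHS]inv_qpoch_lt // mul0r mulr0 big1 // => k _.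
  case: (leqP k L) => kL.
    by rewrite (@inv_qpoch_lt k) ?mul0r ?mulr0 //; lia.
  by rewrite inv_qpoch_lt // mulr0 mul0r.
rewrite -(@sum_nat_shift _ _ j); first last.
- by move=> k Bk; rewrite inv_qpoch_lt ?mulr0 ?mul0r //; lia.
- by move=> k kj; rewrite (@inv_qpoch_lt k) ?mul0r ?mulr0.
have -> : L%:Z - j%:Z = (L - j)%N%:Z by lia.
have -> : (L + j).+1 = (L - j + j.*2.+1)%N by lia.
rewrite -(@durfee_sum _ _ B); last lia.
rewrite big_distrr /=; apply: eq_bigr => k _.
have -> : (k + j)%:Z - j%:Z = k%:Z by lia.
have -> : L%:Z - (k + j)%N%:Z = (L - j)%N%:Z - k%:Z by lia.
have -> : ((k + j) ^ 2 + (k + j) = (j ^ 2 + j) + k * (k + j.*2.+1))%N by lia.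
have -> : (k + j + j).+1 = (k + j.*2.+1)%N by lia.
rewrite exprD; ring.
Qed.
End InvQpoch.

(** * The product side as a pairing *)

Section Pairing.
Variables (F : fieldType) (q : F).
Hypothesis hq : forall k : nat, (0 < k)%N -> q ^+ k != 1.
Local Notation p := (q ^+ 3).
Local Notation r := (inv_qpoch p).
Local Notation w := (q + q^-1).

Lemma expr3_neq1 (k : nat) : (0 < k)%N -> p ^+ k != 1.
Proof. by move=> k0; rewrite -exprM hq // muln_gt0. Qed.
Let hp := expr3_neq1.

(** By Euler, the coefficient of x^m in (-x; q)_oo. *)
Definition euler_coef (m : nat) : F := q ^+ 'C(m, 2) * inv_qpoch q m%:Z.

Lemma euler_coefS m :
  (1 - q ^+ m.+1) * euler_coef m.+1 = q ^+ m * euler_coef m.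
Proof.
rewrite /euler_coef (inv_qpoch_pred hq m) binS bin1 exprD; ring.
Qed.

Variable B : nat.

(* The pairing of [theta] with the coefficients of the power series
   (-q^a x; q)_oo / (p^b x^2; p)_oo; raising [a] or [b] by one is the
   q-difference equation of the corresponding product. *)
Definition pairing (a b : nat) (theta : nat -> F) : F :=
  \sum_(0 <= m < B) \sum_(0 <= n < B)
    q ^+ (a * m) * p ^+ (b * n) * (euler_coef m * r n%:Z) * theta (m + n.*2)%N.

(** Makes the truncation in [pairing] lossless: m + 2n < B forces m < B and n < B. *)
Definition supported (theta : nat -> F) := forall s, (B <= s)%N -> theta s = 0.

Lemma eq_pairing a b f g : f =1 g -> pairing a b f = pairing a b g.
Proof. by move=> fg; do 2![apply: eq_bigr => ? _]; rewrite fg. Qed.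

Lemma pairingD a b c f g :
  pairing a b (fun s => f s + c * g s) = pairing a b f + c * pairing a b g.
Proof.
rewrite /pairing big_distrr -big_split /=; apply: eq_bigr => m _.
rewrite big_distrr -big_split /=; apply: eq_bigr => n _; ring.
Qed.

Lemma pairingZ a b c f : pairing a b (fun s => c * f s) = c * pairing a b f.
Proof.
rewrite /pairing big_distrr; apply: eq_bigr => m _.
rewrite big_distrr; apply: eq_bigr => n _ /=; ring.
Qed.

(** Transposes (-q^a x; q)_oo = (1 + q^a x) (-q^(a+1) x; q)_oo: multiplying the series by x amounts
    to shifting the argument of [theta] by one. *)
Lemma pairing_numer a b theta : supported theta ->
  pairing a b theta = pairing a.+1 b (fun s => theta s + q ^+ a * theta s.+1).
Proof.
move=> th0; rewrite pairingD; apply/eqP; rewrite addrC -subr_eq; apply/eqP.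
rewrite [in LHS]/pairing -sumrB.
pose G m := \sum_(0 <= n < B) q ^+ (a * m) * p ^+ (b * n) *
  ((1 - q ^+ m) * euler_coef m * r n%:Z) * theta (m + n.*2)%N.
transitivity (\sum_(0 <= m < B) G m).
  apply: eq_bigr => m _; rewrite -sumrN -big_split; apply: eq_bigr => n _.
  rewrite /= mulSn exprD; ring.
rewrite -(@sum_nat_shift _ G 1); first last.
- by move=> m Bm; rewrite /G big1 // => n _; rewrite th0 ?mulr0 //; lia.
- by case=> // _; rewrite /G big1 // => n _; rewrite expr0 subrr !(mul0r, mulr0).
rewrite /pairing big_distrr; apply: eq_bigr => m _; rewrite /G big_distrr.
apply: eq_bigr => n _; rewrite /= addn1 euler_coefS addSn mulnS mulSn !exprD.
ring.
Qed.

Lemma pairing_denom a b theta : supported theta ->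
  pairing a b.+1 theta = pairing a b (fun s => theta s - p ^+ b * theta s.+2).
Proof.
move=> th0.
under [RHS]eq_pairing => s do rewrite -mulNr.
rewrite pairingD mulNr; apply/eqP; rewrite eq_sym subr_eq addrC -subr_eq; apply/eqP.
rewrite /pairing -sumrB big_distrr; apply: eq_bigr => m _.
rewrite /= -sumrB.
pose G n := q ^+ (a * m) * p ^+ (b * n) *
  (euler_coef m * ((1 - p ^+ n) * r n%:Z)) * theta (m + n.*2)%N.
transitivity (\sum_(0 <= n < B) G n).
  by apply: eq_bigr => n _; rewrite /G mulSn exprD; ring.
rewrite -(@sum_nat_shift _ G 1); first last.
- by move=> n Bn; rewrite /G th0 ?mulr0 //; lia.
- by case=> // _; rewrite /G expr0 subrr !(mul0r, mulr0).
rewrite big_distrr; apply: eq_bigr => n _.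
rewrite /G addn1 -(inv_qpoch_pred hp) doubleS !addnS mulnS exprD /=; ring.
Qed.

(** The dilation x -> p x multiplies x^s by p^s. It raises [a] by 3 since p = q^3, and [b] by 2
    since the denominator is a product in x^2. *)
Lemma pairing_dilate a b theta :
  pairing a.+3 b.+2 theta = pairing a b (fun s => p ^+ s * theta s).
Proof.
apply: eq_bigr => m _; apply: eq_bigr => n _.
have -> : q ^+ (a.+3 * m) = q ^+ (a * m) * p ^+ m.
  by rewrite -exprM -exprD; congr (_ ^+ _); lia.
have -> : p ^+ (b.+2 * n) = p ^+ (b * n) * p ^+ n.*2.
  by rewrite -exprD; congr (_ ^+ _); lia.
rewrite exprD; ring.
Qed.

(** For Phi(x) = (-q^2 x; q)_oo / (x^2; p)_oo this transposes (1 - x^2) (1 - p x^2) Phi(x) = (1 +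
    q^2 x) (1 + q^3 x) (1 + q^4 x) Phi(p x). *)
Lemma pairing_annihilator (eta : nat -> F) : supported eta ->
  pairing 2 0 (fun s => eta s - (1 + p) * eta s.+2 + p * eta s.+4)
  = pairing 2 0 (fun s => p ^+ s * (eta s + (q ^+ 2 + q ^+ 3 + q ^+ 4) * eta s.+1
      + (q ^+ 5 + q ^+ 6 + q ^+ 7) * eta s.+2 + q ^+ 9 * eta s.+3)).
Proof.
move=> h0.
have h k s : (B <= s)%N -> eta (k + s)%N = 0 by move=> Bs; rewrite h0 //; lia.
have hE s : (B <= s)%N -> [/\ eta s = 0, eta s.+1 = 0, eta s.+2 = 0,
    eta s.+3 = 0 & [/\ eta s.+4 = 0, eta s.+4.+1 = 0 & eta s.+4.+2 = 0]].
  move=> Bs; split; last split; [exact: (h 0%N)|exact: (h 1%N)|exact: (h 2%N)|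
    exact: (h 3%N)|exact: (h 4%N)|exact: (h 5%N)|exact: (h 6%N)].
(* Both sides are brought to [pairing 5 0]: the right one by a dilation and two denominator steps,
   the left one by three numerator steps. *)
rewrite -pairing_dilate.
rewrite pairing_denom; last by move=> s /hE[-> -> -> -> _]; ring.
rewrite pairing_denom; last by move=> s /hE[-> -> -> -> [-> -> _]]; ring.
rewrite [LHS]pairing_numer; last by move=> s /hE[-> _ -> _ [-> _ _]]; ring.
rewrite [LHS]pairing_numer; last by move=> s /hE[-> -> -> -> [-> -> _]]; ring.
rewrite [LHS]pairing_numer; last by move=> s /hE[-> -> -> -> [-> -> ->]]; ring.
apply: eq_pairing => s; ring.
Qed.

Definition shifted_pairing (theta : nat -> F) :=
  pairing 2 0 (fun s => theta s + theta s.+1).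

(** Put Psi(x) = (1 + x) Phi(x) in the previous equation. Since 1 + q^3 x = 1 + p x is absorbed into
    Psi(p x), it becomes (1 - x) (1 - p x^2) Psi(x) = (1 + q^2 x) (1 + q^4 x) Psi(p x). *)
Lemma shifted_pairing_annihilator eta : supported eta ->
  shifted_pairing (fun s => eta s - eta s.+1 - p * eta s.+2 + p * eta s.+3
    - p ^+ s * (eta s + (q ^+ 2 + q ^+ 4) * eta s.+1 + q ^+ 6 * eta s.+2)) = 0.
Proof.
move=> h0; have := pairing_annihilator h0.
move/eqP; rewrite -subr_eq0 => /eqP <-; rewrite -mulN1r -pairingD.
apply: eq_pairing => s; rewrite !exprS; ring.
Qed.

Definition theta (M s : nat) : F :=
  p ^+ 'C(s.+1, 2) * qpoch p p M * r (M%:Z - s%:Z).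

(* (1 - p^(2M)) (1 - p^(2M+1)) theta M.-1 s, in a form that is 0 at [M = 0]. *)
Definition theta_pred (M s : nat) : F :=
  p ^+ 'C(s.+1, 2) * (1 + p ^+ M) * (1 - p ^+ M.*2.+1) * qpoch p p M
  * r (M%:Z - s.+1%:Z).

(* The multiplier of the p-difference equation: its value at [s.+1] is forced
   by the coefficient of w in [theta_eta]. *)
Definition eta (M s : nat) : F :=
  p ^+ M.*2.+2 * (p ^+ s)^-1 * p ^+ 'C(s, 2) * qpoch p p M * r (M.+1%:Z - s%:Z).

Hypothesis q0 : q != 0.

Lemma inv_qpochB1 (n k : nat) :
  r (n%:Z - k%:Z) = (1 - p ^+ n.+1 / p ^+ k) * r (n.+1%:Z - k%:Z).
Proof.
have k0 : p ^+ k != 0 by rewrite !expf_neq0.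
by apply: (mulfI k0); rewrite (inv_qpochB hp) mulrA mulrBr mulr1 mulrCA divff // mulr1.
Qed.

(** The defect of the recurrence at [theta] is the operator of [shifted_pairing_annihilator] applied
    to [eta], so its shifted pairing vanishes. *)
Lemma theta_eta M s :
  theta M.+1 s - (1 + p + p ^+ M.*2.+2 * w) * theta M s + p * theta_pred M s
  = eta M s - eta M s.+1 - p * eta M s.+2 + p * eta M s.+3
    - p ^+ s * (eta M s + (q ^+ 2 + q ^+ 4) * eta M s.+1 + q ^+ 6 * eta M s.+2).
Proof.
have p0 : p != 0 by rewrite expf_neq0.
(* After these two rewrites q enters only through p and w, which are then generalized as independent
   variables. *)
have -> : q ^+ 2 + q ^+ 4 = p * w by field.
have -> : q ^+ 6 = p ^+ 2 by rewrite -exprM.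
rewrite /theta /theta_pred /eta.
have SS (n k : nat) : n.+1%:Z - k.+1%:Z = n%:Z - k%:Z by lia.
rewrite !SS (inv_qpochB1 M s.+2) SS (inv_qpochB1 M s.+1) SS (inv_qpochB1 M s).
rewrite qpochS !binS !bin1 !bin0.
move: (q + q^-1) (qpoch _ _ _) (r _) => v Q R.
move: p p0 => y y0; rewrite -[M.*2]muln2 !exprS !exprD exprM !exprS ?expr0 ?expr1.
have x0 : y ^+ s != 0 by rewrite expf_neq0.
move: (y ^+ s) x0 (y ^+ M) (y ^+ 'C(s, 2)) => x x0 P c.
by field; rewrite x0 y0.
Qed.
End Pairing.

(** * The double sum over m and n, and its recurrence *)

Section BaseSum.
Variables (F : fieldType) (q : F).
Hypothesis hq : forall k : nat, (0 < k)%N -> q ^+ k != 1.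
Local Notation p := (q ^+ 3).
Local Notation r := (inv_qpoch p).
Local Notation w := (q + q^-1).
Variable B : nat.

Definition base_sum (M : nat) : F :=
  \sum_(0 <= m < B) \sum_(0 <= n < B)
    q ^+ (2 * m ^ 2 + 6 * m * n + 6 * n ^ 2 + m + 3 * n)
    * (1 + q ^+ (1 + 2 * m + 3 * n)) * qpoch p p M * inv_qpoch q m%:Z * r n%:Z
    * r (M%:Z - 2 * n%:Z - m%:Z).

Lemma theta_eq0 M s : (M < s)%N -> theta q M s = 0.
Proof. by move=> Ms; rewrite /theta inv_qpoch_lt ?mulr0. Qed.

Lemma base_exponent (m n : nat) :
  (2 * m ^ 2 + 6 * m * n + 6 * n ^ 2 + m + 3 * n
   = 3 * 'C((m + n.*2).+1, 2) + 'C(m, 2))%N.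
Proof.
have e k : ('C(k, 2) * 2 = k * k.-1)%N.
  by rewrite bin2 muln2 -[RHS]odd_double_half oddM; case: k => //= k; case: odd.
have := e m; have := e (m + n.*2).+1; case: m => [|m] /=; nia.
Qed.

(** The two terms of 1 + q^(1+2m+3n) give the series (-x; q)_oo / (x^2; p)_oo and q (-q^2 x; q)_oo /
    (p x^2; p)_oo. Their sum is Phi(x) times (1 + x) (1 + q x) + q (1 - x^2) = (1 + q) (1 + x). *)
Lemma base_sum_pairing M : (M < B)%N ->
  base_sum M = (1 + q) * shifted_pairing q B (theta q M).
Proof.
move=> MB.
have th0 s : (B <= s)%N -> theta q M s = 0.
  by move=> Bs; rewrite theta_eq0 //; lia.
have S0 : supported B (theta q M) by [].
have S1 : supported B (fun s => theta q M s + q ^+ 0 * theta q M s.+1).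
  by move=> s Bs; rewrite !th0 ?mulr0 ?addr0 //; lia.
transitivity (pairing q B 0 0 (theta q M) + q * pairing q B 2 1 (theta q M)).
  rewrite /base_sum /pairing big_distrr -big_split; apply: eq_bigr => m _.
  rewrite big_distrr -big_split; apply: eq_bigr => n _ /=.
  rewrite base_exponent /theta /euler_coef exprD exprM !mul0n !expr0 mul1n.
  have -> : M%:Z - 2 * n%:Z - m%:Z = M%:Z - (m + n.*2)%N%:Z by lia.
  have -> : q ^+ (1 + 2 * m + 3 * n) = q * (q ^+ (2 * m) * p ^+ n).
    by rewrite -exprM -exprD -exprS; congr (_ ^+ _); lia.
  ring.
rewrite (pairing_denom hq _ _ S0) (pairing_numer hq _ _ S0).
rewrite (pairing_numer hq _ _ S1) -pairingD /shifted_pairing.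
rewrite -pairingZ; apply: eq_pairing => s; ring.
Qed.

Lemma shifted_pairingD c f g :
  shifted_pairing q B (fun s => f s + c * g s)
  = shifted_pairing q B f + c * shifted_pairing q B g.
Proof.
by rewrite /shifted_pairing -pairingD; apply: eq_pairing => s; ring.
Qed.

Lemma shifted_pairingZ c f :
  shifted_pairing q B (fun s => c * f s) = c * shifted_pairing q B f.
Proof.
by rewrite /shifted_pairing -pairingZ; apply: eq_pairing => s; ring.
Qed.

Hypothesis q0 : q != 0.

Definition rec_coef1 M := 1 + p + p ^+ M.*2.+2 * w.
(** Indexed by the term it multiplies: the coefficient of X_(M-1) in the recurrence for X_(M+1) is
    [rec_coef2 M.-1]. *)
Definition rec_coef2 M := p * (1 - p ^+ M.*2.+2) * (1 - p ^+ M.*2.+3).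

Lemma base_sum_rec M : (M.+1 < B)%N ->
  base_sum M.+1 = rec_coef1 M * base_sum M
    - if M is k.+1 then rec_coef2 k * base_sum k else 0.
Proof.
move=> MB; have hE : supported B (eta q M).
  by move=> s Bs; rewrite /eta inv_qpoch_lt ?mulr0 //; lia.
have := shifted_pairing_annihilator hq hE.
have -> : shifted_pairing q B (fun s => eta q M s - eta q M s.+1 - p * eta q M s.+2
    + p * eta q M s.+3 - p ^+ s * (eta q M s + (q ^+ 2 + q ^+ 4) * eta q M s.+1
    + q ^+ 6 * eta q M s.+2))
  = shifted_pairing q B (theta q M.+1) + - rec_coef1 M * shifted_pairing q B (theta q M)
    + p * shifted_pairing q B (theta_pred q M).
  rewrite -!shifted_pairingD; apply: eq_pairing => s.
  by rewrite -!(theta_eta hq q0) /rec_coef1 !mulNr.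
have -> : p * shifted_pairing q B (theta_pred q M) =
    if M is k.+1 then rec_coef2 k * shifted_pairing q B (theta q k) else 0.
  case: {hE} M MB => [|M] MB.
    rewrite /shifted_pairing /pairing big1 ?mulr0 // => m _; rewrite big1 // => n _.
    by rewrite /theta_pred !inv_qpoch_lt // !mulr0 addr0 mulr0.
  rewrite -!shifted_pairingZ; apply: eq_pairing => s.
  have E t : p * theta_pred q M.+1 t = rec_coef2 M * theta q M t.
    rewrite /theta_pred /theta /rec_coef2 qpochS.
    have -> : M.+1%:Z - t.+1%:Z = M%:Z - t%:Z by lia.
    rewrite doubleS (_ : p ^+ M.*2.+2 = p ^+ M.+1 * p ^+ M.+1); first ring.
    by rewrite -exprD; congr (_ ^+ _); lia.
  by rewrite !E.
move=> e; rewrite !base_sum_pairing ?(ltnW MB) //.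
case: M MB e {hE} => [|M] MB e; rewrite ?(base_sum_pairing (ltnW (ltnW MB))).
  by move/eqP: e; rewrite addr0 mulNr subr_eq0 => /eqP ->; ring.
apply/eqP; rewrite -subr_eq0; apply/eqP; rewrite -[RHS](mulr0 (1 + q)) -e; ring.
Qed.
End BaseSum.

(** * The bilateral side *)

Section ThetaSide.
Variables (F : fieldType) (q : F).
Hypothesis hq : forall k : nat, (0 < k)%N -> q ^+ k != 1.
Local Notation p := (q ^+ 3).
Local Notation r := (inv_qpoch p).
Local Notation w := (q + q^-1).
Let hp := expr3_neq1 hq.
Variable B : nat.

(** The bilateral sum folded onto j >= 0: the indices j and -1-j share their q-binomial coefficient,
    and 3(-1-j)^2 + 2(-1-j) = 3j^2 + 4j + 1. *)
Definition theta_sum (M : nat) : F :=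
  \sum_(0 <= j < B) (q ^+ (3 * j ^ 2 + 2 * j) + q ^+ (3 * j ^ 2 + 4 * j + 1))
    * (qpoch p p M.*2.+1 * (r (M%:Z - j%:Z) * r (M + j).+1%:Z)).

Definition bterm (M j : nat) : F :=
  p ^+ (j ^ 2 + j) * qpoch p p M.*2.+1 * r (M%:Z - j%:Z) * r (M + j).+1%:Z.

(* (1 - p^(2M)) (1 - p^(2M+1)) bterm M.-1 j, in a form that is 0 at [M = 0]. *)
Definition bterm_pred (M j : nat) : F :=
  p ^+ (j ^ 2 + j) * qpoch p p M.*2.+1 * r (M%:Z - j.+1%:Z) * r (M + j)%N%:Z.

(* The bilateral coefficient is invariant under j <-> -1-j, so the one with
   index j - 1 is [bterm M 0] for [j = 0]. *)
Definition bterm_shift (M j : nat) : F :=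
  p ^+ (j ^ 2 - j) * qpoch p p M.*2.+1 * r (M.+1%:Z - j%:Z) * r (M + j)%N%:Z.

Definition weight (j : nat) : F := (q ^+ j)^-1 + q ^+ j.+1.

Lemma bterm_shift0 M : bterm_shift M 0 = bterm M 0.
Proof. by rewrite /bterm_shift /bterm !subr0 addn0; ring. Qed.

Lemma bterm_shiftS M j : bterm_shift M j.+1 = bterm M j.
Proof.
rewrite /bterm_shift /bterm addnS.
have -> : (j.+1 ^ 2 - j.+1 = j ^ 2 + j)%N by lia.
by have -> : M.+1%:Z - j.+1%:Z = M%:Z - j%:Z by lia.
Qed.

Lemma bterm_eq0 M j : (M < j)%N -> bterm M j = 0.
Proof. by move=> Mj; rewrite /bterm inv_qpoch_lt // mulr0 mul0r. Qed.

Hypothesis q0 : q != 0.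

Lemma theta_sum_weight M :
  theta_sum M = \sum_(0 <= j < B) bterm M j * weight j.
Proof.
apply: eq_bigr => j _; rewrite /bterm /weight.
have x0 : q ^+ j != 0 by rewrite expf_neq0.
have -> : q ^+ (3 * j ^ 2 + 2 * j) = p ^+ (j ^ 2 + j) / q ^+ j.
  apply: (mulIf x0); rewrite divfK // -exprM -exprD; congr (_ ^+ _); lia.
have -> : q ^+ (3 * j ^ 2 + 4 * j + 1) = p ^+ (j ^ 2 + j) * q ^+ j.+1.
  by rewrite -exprM -exprD; congr (_ ^+ _); lia.
ring.
Qed.

(** Boundary case of [weightS]: by the symmetry j <-> -1-j the weight at -1 equals [weight 0]. *)
Lemma weight0 : w * weight 0 = weight 1 + weight 0.
Proof. by rewrite /weight expr0 !exprS expr0 invr1; field. Qed.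

Lemma weightS j : w * weight j.+1 = weight j.+2 + weight j.
Proof.
have x0 : q ^+ j != 0 by rewrite expf_neq0.
by rewrite /weight !exprS; field; rewrite x0 q0.
Qed.

Lemma bterm_rec M j :
  bterm M.+1 j - (1 + p) * bterm M j + p * bterm_pred M j
  = p ^+ M.*2.+2 * (bterm_shift M j + bterm M j.+1).
Proof.
have p0 : p != 0 by rewrite expf_neq0.
rewrite /bterm /bterm_pred /bterm_shift.
rewrite (inv_qpochB1 hq q0 M j.+1).
have -> : M.+1%:Z - j.+1%:Z = M%:Z - j%:Z by lia.
rewrite (inv_qpochB1 hq q0 M j) (addSn M) (addnS M).
rewrite (inv_qpoch_pred hp (M + j)) (inv_qpoch_pred hp (M + j).+1).
rewrite doubleS (qpochS p M.*2.+2) (qpochS p M.*2.+1).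
(* All powers of p are expressed through p^(j^2-j), the lowest one present; the subtraction is exact
   since j <= j^2. *)
have -> : (j ^ 2 + j = j ^ 2 - j + (j + j))%N by nia.
have -> : (j.+1 ^ 2 + j.+1 = j ^ 2 - j + (j + j + j + j + 2))%N by nia.
move: (qpoch _ _ _) (r (M.+1%:Z - _)) (r (M + j).+2%:Z) => Q R R'.
move: p p0 => y y0; rewrite -addnn !exprS !exprD !exprS.
have x0 : y ^+ j != 0 by rewrite expf_neq0.
move: (y ^+ j) x0 (y ^+ M) (y ^+ (j ^ 2 - j)) => x x0 P c.
by field; rewrite x0 y0.
Qed.

(** Summation by parts: [weightS] turns w into shifts of the weights, which are moved onto the
    coefficients. The terms at the upper end vanish by [bterm_eq0]; at j = 0, [weight0] matches
    [bterm_shift0]. *)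
Lemma mulw_theta_sum M : (M.+1 < B)%N ->
  w * theta_sum M
  = \sum_(0 <= j < B) (bterm_shift M j + bterm M j.+1) * weight j.
Proof.
rewrite theta_sum_weight; case: B => // b; rewrite ltnS => Mb.
pose g j := bterm M j * weight j.+1.
have eg : \sum_(0 <= j < b) g j = g 0%N + \sum_(0 <= j < b) g j.+1.
  by rewrite -[RHS](big_nat_recl b 0 g) // big_nat_recr //= {3}/g bterm_eq0 // mul0r addr0.
rewrite big_distrr /= (eq_bigr (fun j => bterm M j * (w * weight j))); last first.
  by move=> j _; ring.
rewrite big_nat_recl // weight0.
rewrite (eq_bigr (fun j => g j.+1 + bterm M j.+1 * weight j)); last first.
  by move=> j _; rewrite weightS /g; ring.
rewrite [RHS](eq_bigr (fun j => bterm_shift M j * weight j + bterm M j.+1 * weight j));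
  last by move=> j _; ring.
rewrite !big_split /= [X in _ = X + _]big_nat_recl // bterm_shift0.
rewrite [X in _ = _ + X]big_nat_recr //= [bterm M b.+1]bterm_eq0; last exact: leqW.
rewrite mul0r addr0.
rewrite [X in _ = _ + X + _](eq_bigr g) => [|j _]; last by rewrite bterm_shiftS.
rewrite eg [g 0%N]/g; ring.
Qed.

Lemma theta_sum_rec M : (M.+1 < B)%N ->
  theta_sum M.+1 = rec_coef1 q M * theta_sum M
    - if M is k.+1 then rec_coef2 q k * theta_sum k else 0.
Proof.
move=> MB; rewrite /rec_coef1 mulrDl -[_ * w * _]mulrA (mulw_theta_sum MB).
have <- : p * \sum_(0 <= j < B) bterm_pred M j * weight j =
    if M is k.+1 then rec_coef2 q k * theta_sum k else 0.
  case: M {MB} => [|M].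
    by rewrite big1 ?mulr0 // => j _; rewrite /bterm_pred inv_qpoch_lt // !(mulr0, mul0r).
  rewrite theta_sum_weight !big_distrr; apply: eq_bigr => j _ /=.
  rewrite /bterm_pred /bterm /rec_coef2 doubleS !qpochS addSn.
  have -> : M.+1%:Z - j.+1%:Z = M%:Z - j%:Z by lia.
  ring.
rewrite !theta_sum_weight !big_distrr -big_split -sumrB; apply: eq_bigr => j _.
have -> : bterm M.+1 j = p ^+ M.*2.+2 * (bterm_shift M j + bterm M j.+1)
    + (1 + p) * bterm M j - p * bterm_pred M j by rewrite -bterm_rec; ring.
rewrite /=; ring.
Qed.
End ThetaSide.

(** * Comparison of the two sides through their common recurrence *)

Lemma eq_three_term (F : fieldType) (c d : nat -> F) (B : nat) (X Y : nat -> F) :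
  X 0%N = Y 0%N ->
  (forall M, (M.+1 < B)%N ->
    X M.+1 = c M * X M - if M is k.+1 then d k * X k else 0) ->
  (forall M, (M.+1 < B)%N ->
    Y M.+1 = c M * Y M - if M is k.+1 then d k * Y k else 0) ->
  forall M, (M < B)%N -> X M = Y M.
Proof.
move=> XY0 hX hY; elim/ltn_ind => -[//|M] IH MB.
rewrite hX // hY // IH //; last exact: ltnW.
(* At [M = 0] the recurrence has no second term, so one initial value suffices. *)
by case: M IH MB => // M IH MB; rewrite IH //; lia.
Qed.

Lemma qpoch_0 (F : fieldType) n : qpoch (0 : F) 0 n = 1.
Proof. by rewrite /qpoch big1 // => k _; rewrite mul0r subr0. Qed.

Section BaseIdentityProof.
Variables (F : fieldType) (q : F).
Hypothesis hq : forall k : nat, (0 < k)%N -> q ^+ k != 1.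

Lemma inv_qpoch0 (x : F) : inv_qpoch x 0%N%:Z = 1.
Proof. by rewrite /inv_qpoch /qpoch big_nil invr1. Qed.

Lemma base_sum0 B : (0 < B)%N -> base_sum q B 0 = 1 + q.
Proof.
move=> B0; have z (m n : nat) : (0 < m + n)%N ->
    inv_qpoch (q ^+ 3) (0%N%:Z - 2 * n%:Z - m%:Z) = 0.
  move=> mn; have -> : 0%N%:Z - 2 * n%:Z - m%:Z = 0%N%:Z - (m + n.*2)%N%:Z by lia.
  by rewrite inv_qpoch_lt //; lia.
rewrite /base_sum (sum_nat_widen B0); last first.
  by move=> m m0; rewrite big1 // => n _; rewrite z ?mulr0 //; lia.
rewrite big_nat1 (sum_nat_widen B0); last by move=> n n0; rewrite z ?mulr0 //; lia.
rewrite big_nat1 /= !muln0 !mulr0 !subr0 !inv_qpoch0 /qpoch big_nil.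
by rewrite expr0 expr1 !mulr1 mul1r.
Qed.

Lemma theta_sum0 B : (0 < B)%N -> theta_sum q B 0 = 1 + q.
Proof.
move=> B0; rewrite /theta_sum (sum_nat_widen B0); last first.
  by move=> j j0; rewrite inv_qpoch_lt // mul0r !mulr0.
rewrite big_nat1 !muln0 !addn0 subr0 inv_qpoch0 expr0 expr1 mul1r.
by rewrite /inv_qpoch mulfV ?mulr1 //; apply: qpoch_neq0; apply: expr3_neq1.
Qed.

(** The recurrences divide by q, so q = 0 is treated apart: only m = n = 0 and j = 0 contribute, and
    both sides are 1. *)
Lemma base_identity_0 B M : (M < B)%N -> base_sum (0 : F) B M = theta_sum 0 B M.
Proof.
move=> MB; have B0 : (0 < B)%N by exact: leq_ltn_trans MB.
have z3 : 0 ^+ 3 = 0 :> F by rewrite expr0n.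
have r0 (n : nat) : inv_qpoch (0 ^+ 3 : F) n%:Z = 1.
  by rewrite /inv_qpoch z3 qpoch_0 invr1.
transitivity (1 : F).
  rewrite /base_sum (sum_nat_widen B0); last first.
    case=> // m _; rewrite big1 // => n _.
    by rewrite !addnS !addSn ?(expr0n, exprS, mul0r).
  rewrite big_nat1 (sum_nat_widen B0); last first.
    by case=> // n _; rewrite !mulnS !addnS ?(expr0n, exprS, mul0r).
  rewrite big_nat1 /= !muln0 !mulr0 !subr0 r0 !inv_qpoch0 z3 qpoch_0.
  by rewrite expr0 expr1 addr0 !mulr1 mul1r -[X in inv_qpoch X]z3 r0.
rewrite /theta_sum (sum_nat_widen B0); last first.
  case=> // j _; rewrite !mulnS !addnS !expr0n /= addr0 mul0r //.
by rewrite big_nat1 !muln0 !addn0 subr0 !r0 z3 qpoch_0 expr0 expr1 addr0 !mulr1.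
Qed.

Lemma base_identity B M : (M < B)%N -> base_sum q B M = theta_sum q B M.
Proof.
case: (eqVneq q 0) => [->|q0] MB; first exact: base_identity_0.
have B0 : (0 < B)%N by exact: leq_ltn_trans MB.
apply: (@eq_three_term _ (rec_coef1 q) (rec_coef2 q) B) => //.
- by rewrite base_sum0 // theta_sum0.
- by move=> k kB; apply: base_sum_rec.
- by move=> k kB; apply: theta_sum_rec.
Qed.
End BaseIdentityProof.

(** * The Bailey chain *)

Lemma tail_sum1 f (ns : f.-tuple nat) : tail_sum ns 1 = sumn ns.
Proof.
by rewrite sumnE (big_nth 0%N) size_tuple /tail_sum big_add1.
Qed.

Lemma part_cons f n (t : f.-tuple nat) i : (0 < i)%N ->
  part [tuple of n :: t] i.+1 = part t i.
Proof. by case: i. Qed.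

Lemma tail_sum_cons f n (t : f.-tuple nat) i : (0 < i)%N ->
  tail_sum [tuple of n :: t] i.+1 = tail_sum t i.
Proof.
move=> i0; rewrite /tail_sum big_add1 /=; apply: eq_big_nat => k /andP[ik _].
by rewrite part_cons //; exact: leq_trans ik.
Qed.

Section Chain.
Variables (F : fieldType) (p : F) (G : nat -> F).
Local Notation r := (inv_qpoch p).

(** The part of the summand depending on n_1, ..., n_f, written as nested Bailey steps. Since n_i =
    N_i - N_(i+1), the factor 1/(p;p)_(n_i) arises at the next level as 1/(p;p)_(L-N) with L = N_i;
    the innermost N_f = n_f is passed to [G]. *)
Fixpoint chain_term (L : nat) (s : seq nat) : F :=
  if s is n :: t then
    let N := (n + sumn t)%N in
    p ^+ (N ^ 2 + N) * r (L%:Z - N%:Z)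
    * (if t is [::] then G n else chain_term N t)
  else 0.

Lemma chain_term_lt L s : (L < sumn s)%N -> chain_term L s = 0.
Proof. by case: s => //= n t Ls; rewrite inv_qpoch_lt // mulr0 mul0r. Qed.

Lemma chain_termE f (ns : f.+1.-tuple nat) L :
  chain_term L ns
  = p ^+ (\sum_(1 <= i < f.+2) (tail_sum ns i ^ 2 + tail_sum ns i))
    * r (L%:Z - (tail_sum ns 1)%:Z)
    * (\prod_(1 <= i < f.+1) r (part ns i)%:Z) * G (part ns f.+1).
Proof.
elim: f ns L => [|f IH] ns L; case/tupleP: ns => n t.
  by rewrite !big_nat1 big_geq // tail_sum1 mulr1 tuple0 /= addn0.
rewrite tail_sum1 big_nat_recl // tail_sum1 exprD [LHS]/= ![sumn [tuple of _ :: _]]/=.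
rewrite (eq_big_nat _ _ (F2 := fun i => (tail_sum t i ^ 2 + tail_sum t i)%N)); last first.
  by move=> i /andP[i0 _]; rewrite tail_sum_cons.
rewrite [\prod_(1 <= i < _) _]big_nat_recl // [part _ f.+2]part_cons //.
rewrite (eq_big_nat _ _ (F2 := fun i => r (part t i)%:Z)); last first.
  by move=> i /andP[i0 _]; rewrite part_cons.
have -> : (if tval t is [::] then G n else chain_term (n + sumn t) t)
    = chain_term (n + sumn t) t by case: (tupleP t).
rewrite IH tail_sum1 [part _ 1]/=.
have -> : (n + sumn t)%N%:Z - (sumn t)%:Z = n%:Z by lia.
ring.
Qed.

Variable B : nat.

Definition bailey_op (g : nat -> F) (L : nat) : F :=
  \sum_(0 <= k < B) p ^+ (k ^ 2 + k) * r (L%:Z - k%:Z) * g k.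

Lemma sum_tuple_cons (f : nat) (H : seq nat -> F) :
  \sum_(t : f.+1.-tuple 'I_B) H (map val t)
  = \sum_(0 <= n < B) \sum_(t : f.-tuple 'I_B) H (n :: map val t).
Proof.
rewrite big_mkord pair_bigA /=.
rewrite (reindex (fun x : 'I_B * f.-tuple 'I_B => [tuple of x.1 :: x.2])) //=.
exists (fun t => (thead t, [tuple of behead t])) => [[n t] _|t _] /=.
  by congr (_, _); apply/val_inj.
by rewrite [RHS]tuple_eta.
Qed.

Lemma sum_chain_term f L : (L < B)%N ->
  \sum_(t : f.+1.-tuple 'I_B) chain_term L (map val t) = iter f.+1 bailey_op G L.
Proof.
elim: f L => [|f IH] L LB.
  rewrite sum_tuple_cons; apply: eq_bigr => n _.
  rewrite (big_pred1 [tuple]) => [|t]; last by apply/esym/eqP; rewrite tuple0.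
  by rewrite /= addn0.
rewrite sum_tuple_cons exchange_big iterS /bailey_op.
under [RHS]eq_big_nat => k /andP[_ kB] do rewrite -(IH k kB) big_distrr /=.
rewrite [RHS]exchange_big; apply: eq_bigr => t _ /=.
set s := map val t.
(* The index [k] of [bailey_op] is N_1 = n + [sumn s]; values of [k] below [sumn s] contribute 0. *)
rewrite -[RHS](@sum_nat_shift _ _ (sumn s)); first last.
- by move=> k Bk; rewrite inv_qpoch_lt ?mulr0 ?mul0r //; lia.
- by move=> k ks; rewrite chain_term_lt ?mulr0.
apply: eq_bigr => n _; congr (_ * _).
by rewrite /s {s}; case/tupleP: t.
Qed.

End Chain.

Lemma eq_iter_bailey_op (F : fieldType) (p : F) B g1 g2 f L :
  (forall k, (k < B)%N -> g1 k = g2 k) -> (L < B)%N ->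
  iter f (bailey_op p B) g1 L = iter f (bailey_op p B) g2 L.
Proof.
move=> g12; elim: f L => [|f IH] L LB /=; first exact: g12.
by apply: eq_big_nat => k /andP[_ kB]; rewrite IH.
Qed.

Lemma iter_bailey_op (F : fieldType) (p : F) B (c : nat -> F) f L :
  (forall k : nat, (0 < k)%N -> p ^+ k != 1) -> (L < B)%N ->
  iter f (bailey_op p B) (fun M => \sum_(0 <= j < B)
    c j * (inv_qpoch p (M%:Z - j%:Z) * inv_qpoch p (M + j).+1%:Z)) L
  = \sum_(0 <= j < B) c j * (p ^+ (f * (j ^ 2 + j))
    * (inv_qpoch p (L%:Z - j%:Z) * inv_qpoch p (L + j).+1%:Z)).
Proof.
move=> hp; elim: f L => [|f IH] L LB.
  by apply: eq_bigr => j _; rewrite mul0n mul1r.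
rewrite iterS /bailey_op.
under eq_big_nat => k /andP[_ kB] do rewrite IH // big_distrr /=.
rewrite exchange_big; apply: eq_bigr => j _ /=.
rewrite mulSn exprD -[p ^+ (j ^ 2 + j) * _]mulrC -[_ * p ^+ _ * _]mulrA.
rewrite -(bailey_step hp _ LB) !big_distrr /=; apply: eq_bigr => k _; ring.
Qed.

(** * Reduction of the finitely supported sums to sums over finite ranges *)

Section FiniteSums.
Variables (F : fieldType) (q : F).
Local Notation p := (q ^+ 3).

(** On the support N_1 <= L bounds every n_i, and then 2n + m <= n_f bounds m and n. *)
Lemma summand_neq0 L f m n (ns : f.-tuple nat) : (0 < f)%N ->
  summand q L m n ns != 0 -> [/\ (m <= L)%N, (n <= L)%N & all (leq^~ L) ns].
Proof.
move=> f0; rewrite /summand !mulf_eq0 !negb_or.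
move=> /andP[/andP[/andP[/andP[_ hN] hm] _] _].
move/inv_qpoch_neq0: hN; rewrite subr_ge0 lez_nat => hN.
have hk i : (0 < i <= f)%N -> (part ns i <= L)%N.
  by move=> hi; apply: leq_trans hN; apply: part_le_tail_sum.
move/inv_qpoch_neq0: hm; have := hk f; rewrite f0 leqnn => /(_ isT) hf hm.
split; [lia|lia|apply/(all_nthP 0%N) => i; rewrite size_tuple => i_lt].
exact: (hk i.+1).
Qed.

Lemma fsbig_summand L f : (0 < f)%N ->
  \sum_(x \in [set: nat * nat * f.-tuple nat]) summand q L x.1.1 x.1.2 x.2
  = \sum_(t : f.-tuple 'I_L.+1) \sum_(0 <= m < L.+1) \sum_(0 <= n < L.+1)
      summand q L m n (map_tuple val t).
Proof.
move=> f0.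
pose emb (y : 'I_L.+1 * 'I_L.+1 * f.-tuple 'I_L.+1) : nat * nat * f.-tuple nat :=
  (y.1.1 : nat, y.1.2 : nat, map_tuple val y.2).
have emb_inj : injective emb.
  move=> [[m n] t] [[m' n'] t'] [/val_inj -> /val_inj -> /(inj_map val_inj) e].
  by congr (_, _); apply/val_inj.
rewrite (fsbigE [seq emb y | y <- index_enum _]) //=; first last.
- move=> [[m n] ns] _; apply: contraNeq => /(summand_neq0 f0)[/= mL nL nsL].
  apply/mapP; exists (inord m, inord n, map_tuple (@inord L) ns).
    by rewrite mem_index_enum.
  rewrite /emb /= !inordK //; congr (_, _); apply/val_inj; rewrite /= -map_comp.
  by apply/esym/map_id_in => x /(allP nsL) xL /=; rewrite inordK.
- by rewrite map_inj_uniq // index_enum_uniq.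
rewrite big_map (eq_bigl xpredT) => [|y]; last by rewrite in_setT.
rewrite -(pair_bigA _ (fun (x : 'I_L.+1 * 'I_L.+1) t =>
  summand q L x.1 x.2 (map_tuple val t))) exchange_big; apply: eq_bigr => t _ /=.
rewrite -(pair_bigA _ (fun m n : 'I_L.+1 => summand q L m n (map_tuple val t))).
by rewrite big_mkord; apply: eq_bigr => m _; rewrite big_mkord.
Qed.

(** For fixed n_1, ..., n_f the sum over m and n is [base_sum] at M = n_f, whose factor (p;p)_M is
    the (p;p)_(n_f) of the summand. *)
Lemma sum_summand L f B (ns : f.+1.-tuple nat) :
  \sum_(0 <= m < B) \sum_(0 <= n < B) summand q L m n ns
  = qpoch p p L.*2.+1
    * chain_term p (fun M => inv_qpoch p M.*2.+1%:Z * base_sum q B M) L ns.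
Proof.
rewrite chain_termE /base_sum !mulrA big_distrr; apply: eq_bigr => m _ /=.
rewrite big_distrr; apply: eq_bigr => n _ /=; rewrite /summand.
set e := (_ + 3 * _)%N.
have -> : (2 * L + 1 = L.*2.+1)%N by lia.
have -> : 2 * (part ns f.+1)%:Z + 1 = (part ns f.+1).*2.+1%:Z by lia.
rewrite /e exprD exprM; ring.
Qed.

Lemma qbinomE (c : int) (a b : nat) : c = (a + b)%N%:Z ->
  qbinom p c a%:Z = qpoch p p (a + b) * (inv_qpoch p a%:Z * inv_qpoch p b%:Z).
Proof.
move=> ->; rewrite /qbinom; have -> : (a + b)%N%:Z - a%:Z = b%:Z by lia.
by rewrite /inv_qpoch -invfM.
Qed.

Lemma fsbig_theta (L f : nat) :
  \sum_(j \in [set j : int | - L%:Z - 1 <= j <= L%:Z + 1])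
      q ^ (3 * (f%:Z + 1) * j ^+ 2 + (3 * f%:Z + 2) * j)
      * qbinom p (2 * L%:Z + 1) (L%:Z - j)
  = qpoch p p L.*2.+1 * \sum_(0 <= j < L.+1)
    (q ^+ (3 * j ^ 2 + 2 * j) + q ^+ (3 * j ^ 2 + 4 * j + 1))
    * (p ^+ (f * (j ^ 2 + j))
    * (inv_qpoch p (L%:Z - j%:Z) * inv_qpoch p (L + j).+1%:Z)).
Proof.
(* The indices are paired as j and -1-j = [Negz j] for 0 <= j <= L. This omits only j = L + 1, where
   the lower index L - j is negative and the coefficient is 0. *)
pose r := [seq Posz j | j <- index_iota 0 L.+1]
  ++ [seq Negz j | j <- index_iota 0 L.+1].
have rP j : (j \in r) = (- L%:Z - 1 <= j <= L%:Z).
  rewrite mem_cat; apply/idP/idP.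
    by case/orP=> /mapP[k]; rewrite mem_index_iota => kL ->; lia.
  case: j => k kL; apply/orP; [left|right]; apply: map_f;
    rewrite mem_index_iota; lia.
rewrite (fsbigE r); first last.
- move=> j /= j1; rewrite rP => j2.
  have -> : L%:Z - j = Negz 0 by lia.
  by rewrite mulr0.
- by move=> j /=; rewrite rP; lia.
- rewrite cat_uniq !map_inj_uniq ?iota_uniq ?andbT; try by move=> ? ? [].
  by apply/hasPn => _ /mapP[k _ ->]; apply/mapP => -[].
rewrite big_mkcond big_seq_cond (eq_bigr (fun j =>
  q ^ (3 * (f%:Z + 1) * j ^+ 2 + (3 * f%:Z + 2) * j)
      * qbinom p (2 * L%:Z + 1) (L%:Z - j))); last first.
  by move=> j; rewrite andbT rP => jL; rewrite ifT // inE /=; lia.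
rewrite -big_seq_cond big_cat !big_map big_distrr.
apply: etrans (esym (big_split _ _ _ _ _)) _.
apply: eq_big_nat => j /andP[_ jL]; cbv beta.
have -> : L%:Z - j%:Z = (L - j)%N%:Z by lia.
have -> : L%:Z - Negz j = (L + j).+1%:Z by lia.
rewrite (@qbinomE _ _ (L + j).+1); last by lia.
rewrite (@qbinomE _ _ (L - j)); last by lia.
have -> : 3 * (f%:Z + 1) * Posz j ^+ 2 + (3 * f%:Z + 2) * Posz j
    = (3 * j ^ 2 + 2 * j + 3 * (f * (j ^ 2 + j)))%N%:Z by lia.
have -> : 3 * (f%:Z + 1) * Negz j ^+ 2 + (3 * f%:Z + 2) * Negz j
    = (3 * j ^ 2 + 4 * j + 1 + 3 * (f * (j ^ 2 + j)))%N%:Z by rewrite NegzE; lia.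
rewrite -!exprnP !(exprD q _ (3 * _)) !(exprM q 3 (f * _)).
have -> : (L - j + (L + j).+1 = L.*2.+1)%N by lia.
have -> : ((L + j).+1 + (L - j) = L.*2.+1)%N by lia.
rewrite /=; ring.
Qed.
End FiniteSums.

Unset Implicit Arguments.
Set Strict Implicit.

Theorem theorem17 (F : fieldType) (q : F)
    (hq : forall k : nat, (0 < k)%N -> q ^+ k != 1)
    (L f : nat) (hf : (0 < f)%N) :
  \sum_(x \in [set: nat * nat * f.-tuple nat]) summand q L x.1.1 x.1.2 x.2
  = \sum_(j \in [set j : int | - L%:Z - 1 <= j <= L%:Z + 1])
      q ^ (3 * (f%:Z + 1) * j ^+ 2 + (3 * f%:Z + 2) * j)
      * qbinom (q ^+ 3) (2 * L%:Z + 1) (L%:Z - j).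
Proof.
have hp := expr3_neq1 hq.
case: f hf => // f _; rewrite fsbig_theta fsbig_summand //.
rewrite (eq_bigr _ (fun t _ => sum_summand q L L.+1 (map_tuple val t))).
rewrite -big_distrr sum_chain_term //; congr (_ * _).
rewrite -(iter_bailey_op _ _ hp) //; apply: eq_iter_bailey_op => // k kB.
rewrite (base_identity hq kB) /theta_sum big_distrr; apply: eq_bigr => j _ /=.
(* The summand's 1/(p;p)_(2k+1) cancels the numerator of the q-binomial coefficient in [theta_sum],
   leaving the kernel of [bailey_step]. *)
rewrite mulrCA [X in _ * X]mulrA /inv_qpoch mulVf ?mul1r //.
exact: (qpoch_neq0 hp).
Qed.
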